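(* There are infinitely many positive integers $n$ such that the sequence $(S_{n,132}(c))_{c\ge 0}$ has no internal zeros.
   Context: For $p\in S_n$, $c_{132}(p)$ is the number of subsequences $p_ip_jp_k$ ($i<j<k$) with $p_i<p_k<p_j$. $S_{n,132}(c)$ is the number of $p\in S_n$ with $c_{132}(p)=c$. An integer $c$ is an internal zero of the sequence if $S_{n,132}(c)=0$ but there exist $c_1<c<c_2$ with $S_{n,132}(c_1)\neq0$ and $S_{n,132}(c_2)\ne 0$. *)

(* Defs.v *)
From mathcomp Require Import all_boot all_fingroup.

Set Implicit Arguments.
Unset Strict Implicit.
Unset Printing Implicit Defensive.

(* Permutations act on the positions 0, ..., n-1 and take values 0, ..., n-1;
   an occurrence of 132 is recorded by its triple of positions. *)
Definition occ132 (n : nat) (p : 'S_n) : {set 'I_n * 'I_n * 'I_n} :=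
  [set t : 'I_n * 'I_n * 'I_n |
    let: (i, j, k) := t in [&& i < j, j < k, p i < p k & p k < p j]].

Definition c132 (n : nat) (p : 'S_n) : nat := #|occ132 p|.

Definition S132 (n c : nat) : nat := #|[set p : 'S_n | c132 p == c]|.

Definition internal_zero (s : nat -> nat) (c : nat) : Prop :=
  s c = 0 /\ exists c1 c2 : nat, [/\ c1 < c, c < c2, s c1 <> 0 & s c2 <> 0].

Definition has_no_internal_zeros (s : nat -> nat) : Prop :=
  forall c : nat, ~ internal_zero s c.

(* Main.v *)
Require Import Defs.
From mathcomp Require Import all_boot all_fingroup.
From mathcomp Require Import zify.

(* Let M be the sequence with M n = max_(k < n) (M k + k * 'C(n - k, 2)), the
   largest number of 132-copies in a layered permutation.
   A copy of 132 is a cherry a < b, a < c with b and c incomparable in the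
   dominance order of the permutation. Zykov symmetrization bounds the number of
   cherries of any poset by M: making all maximal elements clones of the best one
   does not decrease this number, and it can be repeated until every non-maximal
   element lies below every maximal one.
   If M n = M k + k * 'C(n - k, 2), M k >= k - 1 and S_k realizes all of 0..M k,
   then S_n realizes all of 0..M n: put above a permutation of S_k a 132-avoiding
   one with an arbitrary number of inversions. Finally, the optimal k moves by
   at most one when n increases by one, so every k is optimal for some n > k. *)

Set Implicit Arguments.
Unset Strict Implicit.
Unset Printing Implicit Defensive.

(** * The layered maximum *)

(** All earlier values are kept in a list because the recursion for M n is not structural. *)
Fixpoint layered_max_seq (n : nat) : seq nat :=
  if n is m.+1 then
    let s := layered_max_seq m in
    rcons s (\max_(k < m) (nth 0 s k + k * 'C(m - k, 2)))
  else [::].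

Definition layered_max (n : nat) : nat := nth 0 (layered_max_seq n.+1) n.

Definition cut (n k : nat) : nat := layered_max k + k * 'C(n - k, 2).

Lemma size_layered_max_seq (n : nat) : size (layered_max_seq n) = n.
Proof. by elim: n => //= n IHn; rewrite size_rcons IHn. Qed.

Lemma nth_layered_max_seq (n k : nat) :
  k < n -> nth 0 (layered_max_seq n) k = layered_max k.
Proof.
elim: n => // n IHn; rewrite ltnS leq_eqVlt => /predU1P[-> //|ltkn].
by rewrite /= nth_rcons size_layered_max_seq ltkn IHn.
Qed.

Lemma layered_maxE (n : nat) : layered_max n = \max_(k < n) cut n k.
Proof.
rewrite /layered_max /= nth_rcons size_layered_max_seq ltnn eqxx.
by apply: eq_bigr => k _; rewrite nth_layered_max_seq.
Qed.

Lemma cut_le (n k : nat) : k <= n -> cut n k <= layered_max n.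
Proof.
rewrite leq_eqVlt => /predU1P[->|ltkn]; first by rewrite /cut subnn muln0 addn0.
by rewrite layered_maxE (leq_bigmax (Ordinal ltkn)).
Qed.

Lemma cut_attained (n : nat) :
  0 < n -> exists2 k, k < n & layered_max n = cut n k.
Proof.
case: n => // n _; rewrite layered_maxE.
have [|k ->] := @eq_bigmax _ (fun k : 'I_n.+1 => cut n.+1 k).
  by rewrite card_ord.
by exists k.
Qed.

Lemma bin2_double (m : nat) : 2 * 'C(m, 2) = m * m.-1.
Proof.
rewrite bin2 mul2n -[RHS]odd_double_half.
by case: m => // m; rewrite oddM /= andNb.
Qed.

Lemma bin2S (m : nat) : 'C(m.+1, 2) = 'C(m, 2) + m.
Proof. by rewrite binS bin1. Qed.

(* The optimal last layer takes at least half of the entries: otherwise,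
   writing the last two layers as l, m above i entries, one does no worse by
   exchanging them, by merging them, or by moving one entry from l to m. *)
Lemma half_cut (n : nat) :
  0 < n -> exists2 k, 2 * k <= n & layered_max n = cut n k.
Proof.
elim/ltn_ind: n => n IHn n_gt0.
pose opt k := (k < n) && (layered_max n == cut n k).
have exopt : exists k, opt k.
  by have [k ltkn eqk] := cut_attained n_gt0; exists k; rewrite /opt ltkn eqk eqxx.
(* The least optimal [k] is taken, so that even a tie with a smaller cut is contradictory. *)
case: (ex_minnP exopt) => k /andP[ltkn /eqP eqk] kmin.
exists k => //; rewrite leqNgt; apply/negP => lt_n_2k.
have noj j : j < k -> cut n k <= cut n j -> False.
  move=> ltjk le_kj; have ltjn := ltn_trans ltjk ltkn.
  have := kmin j; rewrite /opt ltjn eqk eqn_leq le_kj -eqk cut_le ?(ltnW ltjn) //=.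
  by move=> /(_ isT); rewrite leqNgt ltjk.
have k_gt0 : 0 < k by lia.
have [i le_2i_k eqi] := IHn k ltkn k_gt0.
pose l := k - i; pose m := n - k.
have ek : k = i + l by lia.
have en : n = i + l + m by lia.
have bl := bin2_double l; have bm := bin2_double m.
have cutnk : cut n k = layered_max i + i * 'C(l, 2) + (i + l) * 'C(m, 2).
  by rewrite /cut eqi /cut -/l -/m; congr (_ + _ * _).
have [lt_ml|le_lm] := ltnP m l.
  apply: (noj (i + m)); first lia.
  rewrite cutnk /cut (_ : n - (i + m) = l); last lia.
  have := @cut_le (i + m) i (leq_addr _ _); rewrite /cut addKn.
  have : l * 'C(m, 2) <= m * 'C(l, 2).
    rewrite -(leq_pmul2l (isT : 0 < 2)) mulnCA bm [leqRHS]mulnCA bl.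
    by rewrite mulnCA !leq_mul2l; lia.
  nia.
have [le_m_2i|lt_2i_m] := leqP m (2 * i + 1).
  apply: (noj i); first lia.
  rewrite cutnk /cut (_ : n - i = l + m); last lia.
  have -> : 'C(l + m, 2) = 'C(l, 2) + 'C(m, 2) + l * m.
    have := bin2_double (l + m); nia.
  have : 'C(m, 2) <= i * m by nia.
  nia.
apply: (noj k.-1); first lia.
rewrite cutnk /cut (_ : n - k.-1 = m.+1); last lia.
rewrite bin2S.
have := @cut_le k.-1 i ltac:(lia); rewrite /cut (_ : k.-1 - i = l.-1); last lia.
have : 'C(l, 2) = 'C(l.-1, 2) + l.-1 by rewrite -bin2S; congr ('C(_, _)); lia.
have ek1 : k.-1 = i + l.-1 by lia.
rewrite ek1.
have -> : i + l = (i + l.-1).+1 by lia.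
(* Moving the entry loses the left side and gains the right side. *)
have h1 : i * l.-1 + 'C(m, 2) <= (i + l.-1) * m.
  have : m <= i + l.-1 by lia.
  have : 2 * (i * l.-1) <= m * m.-1 by nia.
  have : m * m <= (i + l.-1) * m by rewrite leq_mul2r; lia.
  have : m * m.-1 <= m * m by rewrite leq_mul2l leq_pred orbT.
  lia.
move=> ->; rewrite mulSn !mulnDr; lia.
Qed.

Definition half_optimal (n k : nat) : Prop := 2 * k <= n /\ layered_max n = cut n k.

Lemma cutS (n k : nat) : k <= n -> cut n.+1 k = cut n k + k * (n - k).
Proof. by move=> lekn; rewrite /cut subSn // bin2S mulnDr addnA. Qed.

(** The difference [cut n.+1 j.+1 - cut n j] is [layered_max j.+1 - layered_max j + 'C(n - j, 2)].
    It weakly decreases in [j] if the second difference of [layered_max] at [j] is at most [n - j];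
    the bound [j] suffices as long as [2 * j <= n]. *)
Definition second_diff_le (i : nat) : Prop :=
  layered_max i.+1 + layered_max i.-1 <= 2 * layered_max i + i.

(* Increasing differences in (n, k), resp. in (n, n - k), make the optimal cut
   weakly increasing, resp. increasing by at most one. *)
Lemma half_optimal_succ (n k : nat) :
  0 < n -> (forall i, 0 < i -> 2 * i <= n -> second_diff_le i) ->
  half_optimal n k -> half_optimal n.+1 k \/ half_optimal n.+1 k.+1.
Proof.
move=> n_gt0 Hsd [le2k optk].
have [o le2o opto] := @half_cut n.+1 isT.
have [ltok|lekoo] := leqP o k.
  left; split; first lia.
  apply/eqP; rewrite eqn_leq cut_le ?andbT; last lia.
  rewrite opto !cutS; try lia.
  have : cut n o <= cut n k by rewrite -optk cut_le; lia.
  have : o * (n - o) <= k * (n - k) by nia.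
  lia.
right; split; first lia.
have step : forall j, k <= j -> 2 * j < n ->
   cut n.+1 j.+1 + cut n k <= cut n.+1 k.+1 + cut n j.
  suff D : forall d, 2 * (k + d) < n ->
    layered_max (k + d).+1 + layered_max k + 'C(n - (k + d), 2)
      <= layered_max k.+1 + layered_max (k + d) + 'C(n - k, 2).
    move=> j lekj lt2j; have := D (j - k).
    rewrite subnKC // => /(_ lt2j).
    rewrite /cut !subSS; nia.
  elim=> [|d IHd]; first by rewrite addn0 => _; lia.
  rewrite addnS => lt2.
  have := IHd ltac:(lia).
  have := Hsd (k + d).+1 isT ltac:(lia); rewrite /second_diff_le /=.
  have -> : n - (k + d) = (n - (k + d).+1).+1 by lia.
  rewrite bin2S; lia.
case: o lekoo le2o opto => // j lekj le2j optj.
apply/eqP; rewrite eqn_leq cut_le ?andbT; last lia.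
rewrite optj.
have := step j lekj ltac:(lia).
have : cut n j <= cut n k by rewrite -optk cut_le; lia.
lia.
Qed.

Lemma layered_max_small (n : nat) : n <= 2 -> layered_max n = 0.
Proof.
have e0 : layered_max 0 = 0 by rewrite layered_maxE big_ord0.
have e1 : layered_max 1 = 0.
  by rewrite layered_maxE big_ord_recr big_ord0 /= /cut e0.
case: n => [|[|[|//]]] _ //.
by rewrite layered_maxE !big_ord_recr big_ord0 /= /cut e0 e1.
Qed.

(** The optimal cut is followed through three consecutive sizes by [half_optimal_succ], whose
    hypothesis only involves indices up to half the size, so strong induction applies. *)
Lemma layered_max_second_diff (i : nat) : 0 < i -> second_diff_le i.
Proof.
elim/ltn_ind: i => N IHN N_gt0.
case: N N_gt0 IHN => [//|[_ _|N _ IHN]].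
  by rewrite /second_diff_le /= !layered_max_small.
rewrite /second_diff_le /=.
have [b le2b optb] := @half_cut N.+1 isT.
have lm j := @cut_le N.+2 j.
have Hsd n i : n <= N.+2 -> 0 < i -> 2 * i <= n -> second_diff_le i.
  by move=> ? ? ?; apply: IHN; lia.
have [g1|g1] := @half_optimal_succ N.+1 b isT (fun i => @Hsd N.+1 i ltac:(lia)) (conj le2b optb);
have [[_ g2]|[_ g2]] := @half_optimal_succ N.+2 _ isT (fun i => @Hsd N.+2 i ltac:(lia)) g1;
  rewrite optb g2.
(* No move: the second difference of [cut] in its first argument is [b]. *)
- rewrite cutS; last lia. have := lm b ltac:(lia).
  rewrite cutS; last lia. have : b <= N.+2 by lia.
  rewrite (_ : N.+2 - b = (N.+1 - b).+1); last lia.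
  nia.
(* One move, here and in the next case: [layered_max N.+2] is bounded below once by cut [b] and once
   by cut [b.+1]. *)
- have := lm b ltac:(lia); have := lm b.+1 ltac:(lia).
  rewrite (@cutS N.+2 b.+1); last lia.
  rewrite (@cutS N.+1 b); last lia.
  rewrite subSS.
  nia.
- have := lm b ltac:(lia); have := lm b.+1 ltac:(lia).
  rewrite (@cutS N.+2 b.+1); last lia.
  rewrite (@cutS N.+1 b); last lia.
  rewrite subSS.
  nia.
(* Two moves: the last layer has the same size all three times, so the binomial terms cancel and the
   induction hypothesis at [b.+1] remains. *)
- have := lm b.+1 ltac:(lia).
  have := IHN b.+1 ltac:(lia) isT.
  rewrite /second_diff_le /cut !subSS /=.
  nia.
Qed.

(** The optimal cut starts at 0 and moves by at most one, so it cannot skip [k]; it cannot stay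
    below [k] forever, because cut [k] eventually overtakes every smaller one. *)
Lemma every_cut_optimal (k : nat) :
  0 < k -> exists2 n, k < n & layered_max n = cut n k.
Proof.
move=> k_gt0.
suff main n : 0 < n -> (exists2 j, j < k & half_optimal n j)
    \/ exists2 n, k < n & layered_max n = cut n k.
  have [N eN] : exists N, N = (2 * k).+1 by exists (2 * k).+1.
  (* Beyond [N], cut [k] gains at least one per step on cut [j], so [s] steps outweigh any lead at
     [N]. *)
  pose s := (layered_max N).+1.
  have [|[j ltjk [_ optj]]|//] := main (N + s); first lia.
  have growth t : cut (N + t) j + t <= cut (N + t) k + cut N j.
    elim: t => [|t IHt]; first by rewrite !addn0 leq_addl.
    rewrite [N + _]addnS !cutS; try lia.
    have : j * (N + t - j) < k * (N + t - k).
      have [d ek] : exists d, k = j + d.+1 by exists (k - j).-1; lia.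
      have [u [eu ltju]] : exists u, N + t - k = u /\ j < u.
        by exists (N + t - k); lia.
      rewrite eu (_ : N + t - j = u + d.+1); last lia.
      nia.
    move: (j * _) (k * _) IHt => P Q; lia.
  have := growth s; have := @cut_le (N + s) k ltac:(lia).
  have := @cut_le N j ltac:(lia).
  rewrite optj /s; lia.
elim: n => // -[_ _|n IHn _].
  by left; exists 0 => //; split=> //; rewrite /cut !layered_max_small.
have [[j ltjk gj]|] := IHn isT; last by right.
have [gj'|gj'] := @half_optimal_succ n.+1 j isT (fun i i_gt0 _ => layered_max_second_diff i_gt0) gj.
  by left; exists j.
have [ltj'k|lekj'] := ltnP j.+1 k; first by left; exists j.+1.
right; exists n.+2; case: gj' => le2 opt; first lia.
by rewrite opt; congr (cut _ _); lia.
Qed.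

Lemma layered_max4 : layered_max 4 = 3.
Proof.
have e3 : layered_max 3 = 1.
  by rewrite layered_maxE !big_ord_recr big_ord0 /= /cut !layered_max_small.
by rewrite layered_maxE !big_ord_recr big_ord0 /= /cut e3 !layered_max_small.
Qed.

(** Already the cut at 1 gives ['C(k - 1, 2)]. The bound puts every remainder modulo [k] in the
    range 0..M k. *)
Lemma layered_max_ge (k : nat) : 4 <= k -> k.-1 <= layered_max k.
Proof.
move=> k_ge4; have := @cut_le k 1 ltac:(lia).
rewrite /cut layered_max_small // mul1n.
have := bin2_double (k - 1); nia.
Qed.

(** * Zykov symmetrization for cherries *)

Section Cherries.
Variable T : finType.
Implicit Types (lt : rel T) (S A R : {set T}) (x y a b c : T).

Definition incomparable lt b c := [&& b != c, ~~ lt b c & ~~ lt c b].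

Definition common_below lt S b c := #|[set a in S | lt a b && lt a c]|.

(* Every cherry is counted twice, b and c being ordered. *)
Definition cherries lt S : nat :=
  \sum_(b in S) \sum_(c in S) incomparable lt b c * common_below lt S b c.

Definition side_cherries lt S b : nat :=
  \sum_(c in S) incomparable lt b c * common_below lt S b c.

Lemma incomparableC lt b c : incomparable lt b c = incomparable lt c b.
Proof. by rewrite /incomparable eq_sym [~~ lt b c && _]andbC. Qed.

Lemma common_belowC lt S b c : common_below lt S b c = common_below lt S c b.
Proof. by apply: eq_card => a; rewrite !inE [lt a b && _]andbC. Qed.

Definition maximal_in lt S A := forall a y, a \in A -> y \in S -> ~~ lt a y.

Lemma common_belowD lt S A b c :
  maximal_in lt S A -> b \in S -> common_below lt S b c = common_below lt (S :\: A) b c.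
Proof.
move=> maxA bS; apply: eq_card => a; rewrite !inE.
by case: (boolP (a \in A)) => // aA; rewrite (negPf (maxA a b aA bS)) andbF.
Qed.

(** No element of [A] lies below anything in [S], so the bottoms of cherries are in [S :\: A] and
    distinct elements of [A] are incomparable. *)
Lemma cherries_split lt S A : A \subset S -> maximal_in lt S A ->
  cherries lt S = cherries lt (S :\: A)
    + \sum_(b in A) (2 * side_cherries lt (S :\: A) b
        + \sum_(c in A | c != b) common_below lt (S :\: A) b c).
Proof.
move=> sAS maxA; set R := S :\: A.
pose F b c := incomparable lt b c * common_below lt R b c.
have splitS (G : T -> nat) : \sum_(b in S) G b = \sum_(b in A) G b + \sum_(b in R) G b.
  rewrite (bigID (mem A)) /=; congr (_ + _); apply: eq_bigl => b; rewrite ?inE.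
    by apply: andb_idl => /(subsetP sAS).
  by rewrite andbC.
have -> : cherries lt S = \sum_(b in S) \sum_(c in S) F b c.
  by apply: eq_bigr => b bS; apply: eq_bigr => c cS; rewrite (common_belowD _ maxA bS).
have -> : cherries lt R = \sum_(b in R) \sum_(c in R) F b c by [].
rewrite splitS addnC.
under [X in X + _]eq_bigr do rewrite splitS.
under [X in _ + X]eq_bigr do rewrite splitS.
rewrite [X in X + _]big_split /= [X in _ + X = _]big_split /= [RHS]addnC -/R.
rewrite [X in _ = X + _]big_split /= -big_distrr /=.
have -> : \sum_(b in A) side_cherries lt R b = \sum_(b in A) \sum_(c in R) F b c by [].
rewrite [X in X + _ + _]exchange_big /=.
have -> : \sum_(b in A) \sum_(c in R) F c b = \sum_(b in A) \sum_(c in R) F b c.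
  apply: eq_bigr => b _; apply: eq_bigr => c _.
  by rewrite /F incomparableC common_belowC.
have -> : \sum_(b in A) \sum_(c in A) F b c
        = \sum_(b in A) \sum_(c in A | c != b) common_below lt R b c.
  apply: eq_bigr => b bA; rewrite big_mkcondr; apply: eq_bigr => c cA.
  have bS := subsetP sAS b bA; have cS := subsetP sAS c cA.
  rewrite /F /incomparable (negPf (maxA b c bA cS)) (negPf (maxA c b cA bS)) !andbT.
  by rewrite eq_sym; case: eqP; rewrite ?mul1n.
lia.
Qed.

Definition below lt S b := #|[set a in S | lt a b]|.

Lemma common_below_le lt S b c : common_below lt S b c <= below lt S b.
Proof.
by apply/subset_leq_card/subsetP => a; rewrite !inE => /and3P[-> ->].
Qed.

(** The contribution of each element of [A] if all of them were clones of [b]. *)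
Definition weight lt S A b :=
  2 * side_cherries lt (S :\: A) b + #|A|.-1 * below lt (S :\: A) b.

Lemma sum_neq_const A b d : b \in A -> \sum_(c in A | c != b) d = #|A|.-1 * d.
Proof.
move=> bA; rewrite sum_nat_const; congr (_ * _).
rewrite (cardsD1 b A) bA /=; apply: eq_card => c; rewrite !inE.
by rewrite unfold_in andbC.
Qed.

Lemma cherries_le_weight lt S A b0 : A \subset S -> maximal_in lt S A ->
  (forall b, b \in A -> weight lt S A b <= weight lt S A b0) ->
  cherries lt S <= cherries lt (S :\: A) + #|A| * weight lt S A b0.
Proof.
move=> sAS maxA best; rewrite (cherries_split sAS maxA) leq_add2l.
rewrite -sum_nat_const; apply: leq_sum => b bA; apply: leq_trans (best b bA).
rewrite /weight leq_add2l -(sum_neq_const _ bA).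
by apply: leq_sum => c _; apply: common_below_le.
Qed.

Definition collapse A b0 x := if x \in A then b0 else x.

(** Pulling [lt] back along [collapse] preserves irreflexivity and transitivity. *)
Definition clone lt A b0 : rel T :=
  fun x y => lt (collapse A b0 x) (collapse A b0 y).

Lemma collapseN A b0 x : x \notin A -> collapse A b0 x = x.
Proof. by rewrite /collapse => /negPf->. Qed.

Lemma clone_maximal lt S A b0 : irreflexive lt -> b0 \in A -> maximal_in lt S A ->
  maximal_in (clone lt A b0) S A.
Proof.
move=> irr b0A maxA a y aA yS; rewrite /clone {1}/collapse aA /collapse.
by case: ifP => yA; rewrite ?irr // maxA.
Qed.

(** Two clones of [b0] share everything below [b0], so the bound of [cherries_le_weight] is
    attained. *)
Lemma cherries_clone lt S A b0 : irreflexive lt ->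
  A \subset S -> maximal_in lt S A -> b0 \in A ->
  cherries (clone lt A b0) S = cherries lt (S :\: A) + #|A| * weight lt S A b0.
Proof.
move=> irr sAS maxA b0A; set lt' := clone lt A b0; set R := S :\: A.
have RnA x : x \in R -> x \notin A by case/setDP.
have ltR x y : x \in R -> y \in R -> lt' x y = lt x y.
  by move=> /RnA xA /RnA yA; rewrite /lt' /clone !collapseN.
have ltA x b : x \in R -> b \in A -> lt' x b = lt x b0.
  by move=> /RnA xA bA; rewrite /lt' /clone collapseN // /collapse bA.
have maxA' : maximal_in lt' S A := clone_maximal irr b0A maxA.
rewrite (cherries_split sAS maxA') -/R.
congr (_ + _).
  apply: eq_bigr => b bR; apply: eq_bigr => c cR.
  rewrite /incomparable !ltR //; congr (_ * _); apply: eq_card => a; rewrite !inE -/R.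
  case: (boolP (a \in S)); rewrite ?andbF // => aS.
  case: (boolP (a \in A)) => //= aA.
  by rewrite !ltR // inE aA.
rewrite -sum_nat_const; apply: eq_bigr => b bA; rewrite /weight -/R.
congr (2 * _ + _).
  apply: eq_bigr => c cR.
  have cS : c \in S by case/setDP: cR.
  rewrite /incomparable [lt' c b]ltA // (negPf (maxA' _ _ bA cS)).
  rewrite (negPf (maxA _ _ b0A cS)).
  have neq x : x \in A -> x != c.
    by move=> xA; apply: contraTneq xA => ->; apply: RnA.
  rewrite !neq //; congr (_ * _); apply: eq_card => a; rewrite !inE.
  case: (boolP (a \in S)); rewrite ?andbF // => aS.
  case: (boolP (a \in A)) => //= aA.
  by rewrite ltA ?ltR // inE aA.
rewrite -(sum_neq_const _ bA); apply: eq_bigr => c /andP[cA _].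
apply: eq_card => a; rewrite !inE.
case: (boolP (a \in S)); rewrite ?andbF // => aS.
case: (boolP (a \in A)) => //= aA.
by rewrite !ltA ?andbb // inE aA.
Qed.

Definition maximals lt S := [set x in S | [forall (y | y \in S), ~~ lt x y]].

Lemma maximalsP lt S : maximal_in lt S (maximals lt S).
Proof. by move=> a y; rewrite inE => /andP[_ /forall_inP]; apply. Qed.

Lemma maximals_neq0 lt S : irreflexive lt -> transitive lt ->
  S != set0 -> maximals lt S != set0.
Proof.
move=> irr tr /set0Pn[x0 x0S].
have [x xS xmin] := @arg_minnP T x0 [in S] (fun x => #|[set y in S | lt x y]|) x0S.
apply/set0Pn; exists x; rewrite inE xS; apply/forall_inP => y yS; apply/negP => ltxy.
have := xmin y yS; apply/negP; rewrite -ltnNge; apply: proper_card.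
apply/properP; split.
  by apply/subsetP => z; rewrite !inE => /andP[-> /(tr _ _ _ ltxy)].
by exists y; rewrite !inE yS ?ltxy // irr.
Qed.

(** Induction on the size of [S] and, for fixed [S], on the number of non-maximal elements, which
    cloning decreases. *)
Lemma cherries_le lt S : irreflexive lt -> transitive lt ->
  cherries lt S <= 2 * layered_max #|S|.
Proof.
move=> irr tr; have [n le_n] := ubnP #|S|.
elim: n lt irr tr S le_n => // n IHn lt irr tr S ltSn.
have [->|S_neq0] := eqVneq S set0; first by rewrite /cherries big_set0.
have [r le_r] := ubnP #|S :\: maximals lt S|.
elim: r lt irr tr le_r => // r IHr lt irr tr ltr.
pose A := maximals lt S; pose R := S :\: A; pose maxA := @maximalsP lt S.
have sAS : A \subset S by apply/subsetP => x; rewrite inE => /andP[].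
have /set0Pn[x0 x0A] := maximals_neq0 irr tr S_neq0.
have [b0 b0A best] := @arg_maxnP T x0 [in A] (weight lt S A) x0A.
have cardR : #|R| + #|A| = #|S|.
  by rewrite addnC -(cardsID A S) (setIidPr sAS).
have A_gt0 : 0 < #|A| by apply/card_gt0P; exists x0.
pose Q := R :\: [set a | lt a b0].
have [Q0|Q_neq0] := eqVneq Q set0.
  (* With all of [R] below [b0], [weight] reduces to pairs inside [A], which contribute at most as
     much as a last layer of size [#|A|]. *)
  have allbelow c : c \in R -> lt c b0.
    by move=> cR; apply: contraT => nlt; rewrite -(in_set0 c) -Q0 in_setD inE nlt.
  apply: leq_trans (cherries_le_weight sAS maxA best) _.
  rewrite -/R.
  have IHR := IHn lt irr tr R ltac:(lia).
  have := @cut_le #|S| #|R| ltac:(lia); rewrite /cut -cardR addKn => le_cut.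
  have side0 : side_cherries lt R b0 = 0.
    rewrite /side_cherries big1 // => c cR.
    by rewrite /incomparable (allbelow c cR) !andbF.
  have leR : below lt R b0 <= #|R|.
    by apply/subset_leq_card/subsetP => a; rewrite inE => /andP[].
  rewrite /weight -/R side0 muln0 add0n.
  have := bin2_double #|A|; nia.
apply: leq_trans (cherries_le_weight sAS maxA best) _.
rewrite -(cherries_clone irr sAS maxA b0A); apply: IHr.
- by move=> x; apply: irr.
- by move=> x y' z; apply: tr.
(* A maximal y among the elements not below b0 becomes maximal in the clone. *)
have /set0Pn[y yQ] := maximals_neq0 irr tr Q_neq0.
have ymax := @maximalsP lt Q y _ yQ.
move: yQ; rewrite inE => /andP[/setDP[yR ny] _]; rewrite inE in ny.
have /setDP[yS yA] := yR.
have maxA' := clone_maximal irr b0A maxA.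
suff : #|S :\: maximals (clone lt A b0) S| < #|R| by move: ltr; rewrite -/A -/R; lia.
apply: proper_card; apply/properP; split.
  apply/subsetP => x; rewrite !inE => /andP[nmx xS]; rewrite xS andbT.
  apply: contra nmx => xA'; rewrite xS; apply/forall_inP => z zS.
  by apply: (maxA' x z) => //; rewrite inE xS.
exists y => //; rewrite !inE yS /= andbT negbK; apply/forall_inP => z zS.
rewrite /clone (collapseN _ yA) /collapse; case: ifP => [//|/negbT zA].
have [zD|zD] := boolP (lt z b0).
  by apply: contra ny => ltyz; apply: tr ltyz zD.
by apply: ymax; rewrite in_setD [z \in [set a | _]]inE zD in_setD zA.
Qed.

End Cherries.

(** * Realizing copy numbers *)

Definition ending_at (f : nat -> nat) (k : nat) : nat :=
  \sum_(j < k) \sum_(i < j) [&& f i < f k & f k < f j].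

Definition occurrences (f : nat -> nat) (n : nat) : nat :=
  \sum_(k < n) ending_at f k.

Lemma sum_ord_lt (n j : nat) (F : nat -> nat) : j <= n ->
  \sum_(i < n | i < j) F i = \sum_(i < j) F i.
Proof.
by move=> lejn; rewrite (big_ord_narrow lejn).
Qed.

Lemma card_triples (n : nat) (f : nat -> nat) :
  #|[set t : 'I_n * 'I_n * 'I_n | let: (i, j, k) := t in
       [&& i < j, j < k, f i < f k & f k < f j]]| = occurrences f n.
Proof.
rewrite cardsE -sum1_card big_mkcond /=.
rewrite (eq_bigr (fun t : 'I_n * 'I_n * 'I_n => nat_of_bool [&& t.1.1 < t.1.2,
   t.1.2 < t.2, f t.1.1 < f t.2 & f t.2 < f t.1.2])); last first.
  by move=> [[i j] k] _; rewrite unfold_in /=; case: [&& _, _, _ & _].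
rewrite -(pair_bigA _ (fun (ij : 'I_n * 'I_n) (k : 'I_n) =>
  nat_of_bool [&& ij.1 < ij.2, ij.2 < k, f ij.1 < f k & f k < f ij.2])) /= exchange_big /=; apply: eq_bigr => k _.
rewrite -(pair_bigA _ (fun i j : 'I_n => nat_of_bool [&& i < j, j < k, f i < f k
  & f k < f j])) /= exchange_big /= /ending_at.
rewrite -(sum_ord_lt (fun j => \sum_(i < j) [&& f i < f k & f k < f j]) (ltnW (ltn_ord k))).
rewrite [RHS]big_mkcond; apply: eq_bigr => j _; case: (ltnP j k) => ltjk; last first.
  by rewrite big1 // => i _; rewrite andbF.
rewrite -(sum_ord_lt (fun i => [&& f i < f k & f k < f j] : nat) (ltnW (ltn_ord j))).
by rewrite [RHS]big_mkcond; apply: eq_bigr => i _; case: (i < j).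
Qed.

(** Ranks among the first [n] letters preserve all comparisons, so words with gaps in their values
    can stand for permutations. *)
Lemma standardize (n : nat) (f : nat -> nat) : {in gtn n &, injective f} ->
  exists p : 'S_n, c132 p = occurrences f n.
Proof.
move=> injf.
pose r (i : 'I_n) := #|[set j : 'I_n | f j < f i]|.
have r_lt i : r i < n.
  rewrite -[ltnRHS]card_ord -cardsT; apply: proper_card; apply/properP.
  by split; [apply: subsetT | exists i; rewrite ?inE ?ltnn].
have r_mono (i j : 'I_n) : f i < f j -> r i < r j.
  move=> lt_ij; apply: proper_card; apply/properP; split.
    by apply/subsetP => x; rewrite !inE => /ltn_trans; apply.
  by exists i; rewrite !inE ?ltnn.
have r_ltE (i j : 'I_n) : (r i < r j) = (f i < f j).
  apply/idP/idP; last exact: r_mono.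
  case: (ltngtP (f i) (f j)) => // [/r_mono lt_ji|eqf]; first lia.
  by rewrite (_ : i = j) ?ltnn //; apply: val_inj; apply: injf eqf; apply: ltn_ord.
have inj_r : injective (fun i => Ordinal (r_lt i)).
  move=> i j [eqr]; apply: val_inj; apply: injf (ltn_ord i) (ltn_ord j) _.
  have := r_ltE i j; have := r_ltE j i; lia.
exists (perm inj_r); rewrite -card_triples /c132 /occ132; congr (#|pred_of_set _|).
by apply/setP => -[[i j] k]; rewrite !inE !permE /= !r_ltE.
Qed.

Lemma c132_occurrences (n : nat) (p : 'S_n) :
  exists f : nat -> nat, [/\ {in gtn n &, injective f},
    forall i, i < n -> f i < n & c132 p = occurrences f n].
Proof.
case: n p => [|n] p.
  exists id; split=> //; rewrite -card_triples /c132.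
  by rewrite !eq_card0 // => -[[[]]].
exists (fun i => p (inord i) : nat); split=> // [i j|].
  rewrite !inE => lti ltj /val_inj/perm_inj /(congr1 val).
  by rewrite /= !inordK.
rewrite -card_triples /c132; congr (#|pred_of_set _|).
by apply/setP => -[[i j] k]; rewrite !inE !inord_val.
Qed.

Lemma ending_at_eq (f g : nat -> nat) (k : nat) :
  (forall i, i <= k -> f i = g i) -> ending_at f k = ending_at g k.
Proof.
move=> eqfg; apply: eq_bigr => j _; apply: eq_bigr => i _.
have ltj := ltn_ord j; have lti := ltn_ord i.
by rewrite !eqfg //; lia.
Qed.

Lemma sum_below (a b : nat) : a <= b -> \sum_(i < b) (i < a) = a.
Proof.
move=> leab; transitivity (\sum_(i < b | i < a) 1).
  by rewrite [RHS]big_mkcond; apply: eq_bigr => i _; case: (i < a).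
by rewrite (sum_ord_lt (fun=> 1) leab) sum1_card card_ord.
Qed.

(** The middle letter of a copy ending at [u] must lie in the block of [q] larger letters, and any
    of the [k] letters before that block can be the first. *)
Lemma ending_at_block (f : nat -> nat) (u k q : nat) : k + q <= u ->
  (forall i, i < u -> (f u < f i) = (k <= i < k + q)) ->
  (forall i, i < k + q -> (f i < f u) = (i < k)) ->
  ending_at f u = k * q.
Proof.
move=> le_u above low.
transitivity (\sum_(j < u) k * (k <= j < k + q)).
  apply: eq_bigr => j _; rewrite above //.
  have [/andP[lekj ltj]|_] := boolP (k <= j < k + q); last first.
    by rewrite muln0 big1 // => i _; rewrite andbF.
  rewrite muln1 -[RHS](sum_below lekj); apply: eq_bigr => i _.
  by rewrite andbT low // (ltn_trans _ ltj).
rewrite -big_distrr /=; congr (k * _); apply: (@addnI k).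
rewrite -[RHS](sum_below le_u).
have leku : k <= u by lia.
rewrite -[X in X + _ = _](sum_below leku) -big_split /=.
by apply: eq_bigr => j _; case: (ltnP j k); case: (ltnP j (k + q)) => //=; lia.
Qed.

Section Extension.
Variables (s : nat -> nat) (k t r : nat).

(* The word s on k letters, then t decreasing letters above it, then one letter
   below exactly r of these, then increasing letters above everything. *)
Definition extension (i : nat) : nat :=
  if i < k then s i
  else if i < k + t then k + 2 * (k + t - i)
  else if i == k + t then k + 2 * (t - r) + 1
  else k + 2 * t + i.+1.

Hypotheses (s_lt : forall i, i < k -> s i < k) (le_rt : r <= t).

(** Counted from [k], the decreasing letters have even heights and the extra letter an odd one,
    which leaves room for it anywhere among them. *)
Lemma extension_inj n : {in gtn k &, injective s} -> {in gtn n &, injective extension}.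
Proof.
move=> s_inj i j _ _; rewrite /extension.
case: (ltnP i k) => lti; case: (ltnP j k) => ltj; first exact: s_inj.
- have := s_lt lti; case: ifP; [lia|case: ifP; lia].
- have := s_lt ltj; case: ifP; [lia|case: ifP; lia].
- case: (ltnP i (k + t)); case: (ltnP j (k + t));
    by case: (i =P k + t); case: (j =P k + t) => /=; lia.
Qed.

Lemma occurrences_extension (z : nat) :
  occurrences extension (k + (t + z.+1)) = occurrences s k + k * ('C(t, 2) + r).
Proof.
rewrite /occurrences big_split_ord /=; congr (_ + _).
  apply: eq_bigr => u _; apply: ending_at_eq => i lei.
  by rewrite /extension (leq_ltn_trans lei).
rewrite big_split_ord /= big_ord_recl /= !addn0 [X in _ + (_ + X)]big1 ?addn0; last first.
  move=> w _; rewrite /bump leq0n add1n (@ending_at_block _ _ k 0) ?muln0 //; first lia.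
    move=> i lti; have := s_lt (i := i); rewrite /extension; do ?case: ifP => ?; lia.
  move=> i lti; have := s_lt (i := i); rewrite /extension; do ?case: ifP => ?; lia.
rewrite mulnDr; congr (_ + _).
  (* Decreasing letter number [w], counted from 0, has a block of [w] larger letters before it. *)
  rewrite -bin2_sum big_mkord big_distrr; apply: eq_bigr => w _ /=.
  have ltw := ltn_ord w.
  apply: ending_at_block => // i lti; have := s_lt (i := i);
    rewrite /extension; do ?case: ifP => ?; lia.
apply: ending_at_block => [|i lti|i lti]; first lia.
  have := s_lt (i := i); rewrite /extension; do ?case: ifP => ?; lia.
have := s_lt (i := i); rewrite /extension; do ?case: ifP => ?; lia.
Qed.

End Extension.

Definition attained (n c : nat) : Prop := exists p : 'S_n, c132 p = c.

Lemma attained_extend (n k t r c : nat) : r <= t -> k + t < n ->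
  attained k c -> attained n (c + k * ('C(t, 2) + r)).
Proof.
move=> le_rt lt_n [p <-]; have [s [s_inj s_lt ->]] := c132_occurrences p.
have [z ->] : exists z, n = k + (t + z.+1) by exists (n - (k + t).+1); lia.
rewrite -(occurrences_extension s_lt le_rt z).
by apply: standardize; apply: extension_inj.
Qed.

(** Consecutive values ['C(t, 2)] and ['C(t.+1, 2)] differ by [t]. Allowing [r = t] reaches the top
    value with [t = m], which leaves a position for the extra letter. *)
Lemma bin2_greedy (m j : nat) : j <= 'C(m.+1, 2) ->
  exists t r, [/\ r <= t, t <= m & j = 'C(t, 2) + r].
Proof.
elim: m => [|m IHm] lej.
  by exists 0, 0; split=> //; move: lej; rewrite !bin_small // leqn0 => /eqP.
have [/IHm[t [r [? ? ?]]]|ltj] := leqP j 'C(m.+1, 2); first by exists t, r; split=> //; lia.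
by exists m.+1, (j - 'C(m.+1, 2)); split=> //; move: lej; rewrite bin2S; lia.
Qed.

Definition all_attained (n : nat) : Prop := forall c, c <= layered_max n -> attained n c.

Lemma all_attained_cut (n k : nat) : k < n -> k.-1 <= layered_max k ->
  layered_max n = cut n k -> all_attained k -> all_attained n.
Proof.
move=> ltkn lekM optk fullk c; rewrite optk /cut => lec.
suff [j [w [lej lew ->]]] : exists j w,
    [/\ j <= 'C(n - k, 2), w <= layered_max k & c = w + k * j].
  have [|t [r [le_rt le_t ->]]] := @bin2_greedy (n - k).-1 j.
    by rewrite prednK // subn_gt0.
  by apply: attained_extend; [|lia|apply: fullk].
(* Large [c] take the maximal [j]; smaller ones are divided by [k], with remainder at most
   [k.-1]. *)
have [lt_c|le_c] := ltnP c (k * 'C(n - k, 2)); last first.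
  by exists 'C(n - k, 2), (c - k * 'C(n - k, 2)); split=> //; lia.
have k_gt0 : 0 < k by case: (k) lt_c.
exists (c %/ k), (c %% k); split.
- by rewrite ltnW // ltn_divLR // mulnC.
- have := ltn_pmod c k_gt0; lia.
- by rewrite {1}(divn_eq c k) addnC mulnC.
Qed.

Lemma infinitely_many_all_attained (N : nat) : exists n, [/\ N < n, 4 <= n & all_attained n].
Proof.
elim: N => [|N [n [ltNn n_ge4 fulln]]].
  (* Size 4 is cut at 1; from 4 on, [layered_max_ge] supplies the condition of
     [all_attained_cut]. *)
  exists 4; split=> //; apply: (@all_attained_cut 4 1) => //.
    by rewrite layered_max4 /cut layered_max_small.
  by move=> c; rewrite layered_max_small // leqn0 => /eqP->; exists 1%g;
     rewrite /c132 eq_card0 // => -[[i j] k]; rewrite !inE [i]ord1 [j]ord1.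
have [n' ltnn' opt] : exists2 n', n < n' & layered_max n' = cut n' n.
  by apply: every_cut_optimal; lia.
exists n'; split; [lia|lia|].
by apply: all_attained_cut opt fulln => //; apply: layered_max_ge.
Qed.

(** * The dominance order of a permutation *)

Section Dominance.
Variables (n : nat) (p : 'S_n).

Definition dominance : rel 'I_n := fun i j => (i < j) && (p i < p j).

Definition inversion (j k : 'I_n) : bool := (j < k) && (p k < p j).

Lemma incomparable_dominance (j k : 'I_n) :
  incomparable dominance j k = inversion j k + inversion k j :> nat.
Proof.
rewrite /incomparable /dominance /inversion.
have [-> | neq] := eqVneq j k; first by rewrite !ltnn.
have : p j != p k :> nat by apply: contra neq => /eqP/val_inj/perm_inj->.
move: neq; rewrite -val_eqE /=.
by case: (ltngtP j k); case: (ltngtP (p j) (p k)).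
Qed.

(** For an inversion [(j, k)], the possible first positions of a copy are exactly the common lower
    bounds in [dominance]. *)
Lemma c132_inversion_sum :
  c132 p = \sum_(j in setT) \sum_(k in setT)
             inversion j k * common_below dominance setT j k.
Proof.
rewrite /c132 /occ132 cardsE -sum1_card big_mkcond /=.
rewrite (eq_bigr (fun t : 'I_n * 'I_n * 'I_n => inversion t.1.2 t.2
    * (dominance t.1.1 t.1.2 && dominance t.1.1 t.2))); last first.
  move=> [[i j] k] _; rewrite unfold_in /= /inversion /dominance.
  case: (ltnP i j) => //= ltij; last by rewrite muln0.
  case: (ltnP j k) => //= ltjk.
  rewrite (ltn_trans ltij ltjk) /=.
  case: (ltnP (p i) (p k)) => ltik; last by rewrite andbF muln0.
  by case: (ltnP (p k) (p j)) => // ltkj; rewrite (ltn_trans ltik ltkj).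
rewrite -(pair_bigA _ (fun (ij : 'I_n * 'I_n) (k : 'I_n) => inversion ij.2 k
    * (dominance ij.1 ij.2 && dominance ij.1 k))) /=.
rewrite -(pair_bigA _ (fun (i j : 'I_n) => \sum_k inversion j k
    * (dominance i j && dominance i k))) /= exchange_big.
apply: eq_big => [j|j _]; first by rewrite inE.
rewrite exchange_big; apply: eq_big => [k|k _]; first by rewrite inE.
rewrite -big_distrr /=; congr (_ * _).
rewrite /common_below cardsE -sum1_card [RHS]big_mkcond /=; apply: eq_bigr => i _.
by rewrite unfold_in inE; case: (_ && _).
Qed.

Lemma c132_cherries : cherries dominance setT = 2 * c132 p.
Proof.
rewrite c132_inversion_sum mul2n -addnn [X in _ = _ + X]exchange_big -big_split.
apply: eq_bigr => j _; rewrite -big_split; apply: eq_bigr => k _ /=.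
by rewrite incomparable_dominance mulnDl [common_below _ _ k j]common_belowC.
Qed.

Lemma c132_le : c132 p <= layered_max n.
Proof.
rewrite -(leq_pmul2l (isT : 0 < 2)) -c132_cherries -[n in layered_max n]card_ord -cardsT.
apply: cherries_le => [i|j i k]; first by rewrite /dominance ltnn.
by move=> /andP[ij pij] /andP[jk pjk]; apply/andP; split; apply: ltn_trans; eassumption.
Qed.

End Dominance.

Theorem theorem4p2 :
  forall N : nat, exists n : nat, N < n /\ has_no_internal_zeros (S132 n).
Proof.
move=> N; have [n [ltNn _ fulln]] := infinitely_many_all_attained N.
exists n; split=> // c [S0 [_ [c2 [_ ltc _ /eqP]]]].
rewrite cards_eq0 => /set0Pn[p]; rewrite inE => /eqP c132p.
have [|q c132q] := fulln c; first by rewrite ltnW // (leq_trans ltc) // -c132p c132_le.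
by move/eqP: S0; rewrite cards_eq0 => /eqP/setP/(_ q); rewrite !inE c132q eqxx.
Qed.
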